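(* Let $V$ be an infinite-dimensional vector space over $K$ with a non-degenerate symmetric bilinear form $\langle\ ,\ \rangle$, and let $C$ be the Clifford algebra of $V$. Then the $GL$-ideal $T(C,V)$ of all weak polynomial identities of the pair $(C,V)$ is generated, as a $GL$-ideal, by the polynomial $[x_1^2,x_2]$.
   Context: $K$ is a fixed field of characteristic $0$. $K\langle X\rangle$ is the free associative algebra over $K$ on $X=\{x_1,x_2,\ldots\}$, and $\mathrm{sp}(X)$ is the vector subspace of $K\langle X\rangle$ spanned by $X$. $[a,b]=ab-ba$. The Clifford algebra $C$ of $V$ is the associative algebra generated by $V$ with $v^2=\langle v,v\rangle\in K$ for all $v\in V$. Let $R$ be an associative algebra and $G$ a vector subspace of $R$ generating $R$ as an algebra. A polynomial $f(x_1,\ldots,x_n)\in K\langle X\rangle$ is a weak (polynomial) identity of the pair $(R,G)$ if $f(g_1,\ldots,g_n)=0$ for all $g_1,\ldots,g_n\in G$. The set $T(R,G)$ of all weak identities of $(R,G)$ is an ideal of $K\langle X\rangle$, closed under linear substitutions of the variables. For a subset $H=\{h_i(x_1,\ldots,x_{n_i})\mid i\in I\}$ of $K\langle X\rangle$, the $GL$-ideal generated by $H$ is the two-sided ideal of $K\langle X\rangle$ generated by all $h_i(\omega_1,\ldots,\omega_{n_i})$ with $i\in I$ and $\omega_j\in\mathrm{sp}(X)$. *)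

(* Defs.v *)
From HB Require Import structures.
From mathcomp Require Import all_boot all_order all_algebra.
From mathcomp Require Import sesquilinear.
From mathcomp.multinomials Require Import monalg.

Set Implicit Arguments.
Unset Strict Implicit.
Unset Printing Implicit Defensive.

Import GRing.Theory.
Local Open Scope ring_scope.

Definition in_span (K : fieldType) (V : lmodType K) (S : V -> Prop) (v : V) :=
  exists2 s : seq (K * V),
    forall t, t \in s -> S t.2 & v = \sum_(t <- s) t.1 *: t.2.

Definition finite_dimensional (K : fieldType) (V : lmodType K) :=
  exists s : seq V, forall v, in_span (fun u => u \in s) v.

Definition nondegenerate_form (K : fieldType) (V : lmodType K)
    (form : V -> V -> K) :=
  forall u, (forall v, form u v = 0) -> u = 0.

(* The unital algebra K<X>: the monoid algebra of the free monoid on nat.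
   X is indexed from 0, so that the informal x_1, x_2, ... are x_ 0, x_ 1, ... *)
Notation free_alg K := {malg K[{fmonom nat}]}.

Definition x_ {K : fieldType} (i : nat) : free_alg K := << fmu i >>.

Definition spX (K : fieldType) : free_alg K -> Prop :=
  in_span (fun p => exists i, p = x_ i).

(* A polynomial f(x_1, ..., x_n) is evaluated at a whole sequence of values;
   only those of the variables occurring in f matter. *)
Definition eval (K : fieldType) (R : lalgType K) (g : nat -> R) :
    free_alg K -> R :=
  mmap (in_alg R) (fun m : {fmonom nat} => \prod_(i <- m) g i).

Definition weak_identity (K : fieldType) (R : algType K) (G : R -> Prop)
    (f : free_alg K) :=
  forall g : nat -> R, (forall i, G (g i)) -> eval g f = 0.

Definition two_sided_ideal (R : nzRingType) (I : R -> Prop) :=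
  [/\ I 0, forall a b, I a -> I b -> I (a + b)
    & forall r a, I a -> I (r * a) /\ I (a * r)].

Definition ideal_generated (R : nzRingType) (S : R -> Prop) (a : R) :=
  forall I : R -> Prop,
    two_sided_ideal I -> (forall s, S s -> I s) -> I a.

Definition GL_ideal_generated (K : fieldType) (H : free_alg K -> Prop) :
    free_alg K -> Prop :=
  ideal_generated (fun p =>
    exists h, H h /\
      exists omega : nat -> free_alg K,
        (forall j, spX (omega j)) /\ p = eval omega h).

Definition commutator (R : nzRingType) (a b : R) : R := a * b - b * a.

Definition clifford_map (K : fieldType) (V : lmodType K) (form : V -> V -> K)
    (A : algType K) (phi : {linear V -> A}) :=
  forall v, phi v ^+ 2 = (form v v)%:A.

(* The algebra generated by V subject to the relations v^2 = <v, v>, given by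
   its universal property: iota : V -> C is the structure map. *)
Definition is_clifford_algebra (K : fieldType) (V : lmodType K)
    (form : V -> V -> K) (C : algType K) (iota : {linear V -> C}) :=
  clifford_map form iota /\
  forall (A : algType K) (phi : {linear V -> A}), clifford_map form phi ->
    exists2 psi : {lrmorphism C -> A},
      forall v, psi (iota v) = phi v
      & forall psi' : {lrmorphism C -> A},
          (forall v, psi' (iota v) = phi v) -> psi' =1 psi.

(* Main.v *)
Require Import Defs.
From HB Require Import structures.
From mathcomp Require Import all_boot all_order all_algebra.
From mathcomp Require Import sesquilinear.
From mathcomp Require finmap.
From mathcomp.multinomials Require Import monalg.
From Stdlib Require Import Classical.

(** Squares of vectors are scalars in the Clifford algebra, so [x_0^2, x_1] is a
weak identity, and weak identities form a two-sided ideal. The content is the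
converse: a weak identity f lies in every two-sided ideal J that contains all
[p^2, q] with p and q linear in the variables.

Write {a, b} = ab + ba. Polarizing p^2 shows that {x_i, x_j} is central
modulo J, just as {u, v} = 2<u, v> is central in C. Both situations are treated
at once: a noncommutative polynomial is a list of (coefficient, word) pairs, and
it is evaluated at elements y_i of an algebra with an ideal J modulo which every
{y_i, y_j} is central; for C this ideal is 0.

Multilinear case ([multilinear_consequence]), by induction on the degree. Moving a
letter z to the front of every word, with zy = {z, y} - yz, gives
  f = z f_0 + sum_i {z, x_i} f_i   modulo J   ([value_move_letter]),
where f_0 and the f_i are multilinear in fewer letters. If f vanishes on vectors,
then so do f_0 and each f_i. For f_0, send z to a vector e with <e, e> != 0 that is
orthogonal to the values of all the other letters: only e f_0 survives, and e is
invertible. For f_i, send both z and x_i to such an e: only 2<e, e> f_i survives.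
It is enough to test f on vectors that are anisotropic and pairwise equal or
orthogonal, and for those the fresh vector e always exists: otherwise all vectors
orthogonal to the given ones would be isotropic, so that by nondegeneracy the given
vectors would span V ([fresh_orthogonal_vector]). The induction ends in degree 0,
where 1 <> 0 in C forces the remaining scalar to be 0.

General case ([identity_consequence]). Let d be the largest degree in f. For every
word j of length d, an alternating sum over subsets of {1..d} extracts from f the
multilinear identity
  sum over permutations q of (coefficient of j o q) v_q(1) ... v_q(d)
([polarization]); lower-degree terms cancel because their words cannot use all d
vectors. Setting v_p = x_j(p) and summing over all j gives back d! times the
degree d part of f ([restitution]). In characteristic 0 that part therefore lies
in J; applied to C and its zero ideal, the same statement says that it is itself
an identity, so it can be subtracted from f. *)

Set Implicit Arguments.
Unset Strict Implicit.
Unset Printing Implicit Defensive.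

Import GRing.Theory.
Local Open Scope ring_scope.

(** * Evaluating lists of weighted words *)

Definition anticommutator (R : nzRingType) (a b : R) : R := a * b + b * a.

Definition word_value (R : nzRingType) (T : Type) (y : T -> R) (w : seq T) : R :=
  \prod_(i <- w) y i.

Definition value (K : fieldType) (R : lalgType K) (T : Type) (y : T -> R)
    (F : seq (K * seq T)) : R :=
  \sum_(t <- F) t.1 *: word_value y t.2.

Lemma eq_value (K : fieldType) (R : algType K) (T : eqType) (s : seq T)
    (y1 y2 : T -> R) (F : seq (K * seq T)) :
  (forall t, t \in F -> perm_eq t.2 s) -> {in s, y1 =1 y2} ->
  value y1 F = value y2 F.
Proof.
move=> permF y12; apply: eq_big_seq => t /permF/perm_mem ts.
by congr (_ *: _); apply: eq_big_seq => i; rewrite ts; apply: y12.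
Qed.

(** * Moving a letter to the front modulo an ideal *)

Lemma zero_ideal (R : nzRingType) : two_sided_ideal (fun x : R => x = 0).
Proof. by split=> // [a b -> ->|r a ->]; rewrite ?addr0 ?mulr0 ?mul0r. Qed.

Section Ideals.

Variables (K : fieldType) (R : algType K) (J : R -> Prop).
Hypothesis idealJ : two_sided_ideal J.

Let J0 : J 0. Proof. by case: idealJ. Qed.
Let JD a b : J a -> J b -> J (a + b). Proof. by case: idealJ => _ + _; exact. Qed.
Let Jl r a : J a -> J (r * a). Proof. by case: idealJ => _ _ H /H-/(_ r)[]. Qed.
Let Jr r a : J a -> J (a * r). Proof. by case: idealJ => _ _ H /H-/(_ r)[]. Qed.

Lemma idealZ (c : K) a : J a -> J (c *: a).
Proof. by move=> Ja; rewrite -[a]mul1r scalerAl; apply: Jl. Qed.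

Lemma idealN a : J a -> J (- a).
Proof. by move=> Ja; rewrite -scaleN1r; apply: idealZ. Qed.

Lemma idealB a b : J a -> J b -> J (a - b).
Proof. by move=> Ja Jb; apply/JD => //; apply: idealN. Qed.

Lemma ideal_sum (I : eqType) (r : seq I) (F : I -> R) :
  (forall i, i \in r -> J (F i)) -> J (\sum_(i <- r) F i).
Proof. by move=> JF; rewrite big_seq; apply: big_ind. Qed.

Variable T : eqType.

Definition move_sign (z : T) (w : seq T) : K := (-1) ^+ index z w.

(** The sign of the term {z, i} that appears when z passes i on its way to the
front. Letters after z are never met, whence the value 0. *)
Definition swap_sign (z i : T) (w : seq T) : K :=
  if (index i w < index z w)%N then (-1) ^+ (index z w - (index i w).+1) else 0.

Variable y : T -> R.
Hypothesis anti_central : forall i j k,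
  J (commutator (anticommutator (y i) (y j)) (y k)).

(** Induction on the letters in front of z: if the claim holds for w, moving z once
more across a costs y_a y_z = {y_z, y_a} - y_z y_a, and the factors {y_z, y_i}
already produced commute with y_a modulo J. *)
Lemma move_letter_front z w : uniq w -> z \in w ->
  J (word_value y w -
     (move_sign z w *: (y z * word_value y (rem z w)) +
      \sum_(i <- rem z w) swap_sign z i w *:
         (anticommutator (y z) (y i) * word_value y (rem i (rem z w))))).
Proof.
rewrite /move_sign /swap_sign; elim: w => [//|a w IHw] /=.
case: eqVneq => [<- _ _|a_neq_z].
  rewrite big1 => [|i _]; last by rewrite ltn0 scale0r.
  by rewrite addr0 expr0 scale1r {1}/word_value big_cons subrr.
move=> /andP[aNw uw]; rewrite in_cons eq_sym (negPf a_neq_z) => /= zw.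
have aNrem : a \notin rem z w by apply: contra aNw; apply: mem_rem.
rewrite big_cons /= !eqxx ltn0Sn subn1 /=.
under [in X in J X]eq_big_seq => i iw.
  have -> : (a == i) = false by apply: contraNF aNrem => /eqP ->.
  rewrite ltnS subSS; over.
have step := Jl (y a) (IHw uw zw).
set S1 := \sum_(i <- _) _ in step; set S2 := \sum_(i <- _) _.
have JS : J (y a * S1 - S2).
  rewrite /S1 /S2 mulr_sumr -sumrB; apply: ideal_sum => i _.
  rewrite -scalerAr -scalerBr; apply: idealZ.
  rewrite /word_value big_cons !mulrA -mulrBl; apply: Jr.
  by rewrite -opprB; apply: idealN; apply: anti_central.
have -> : word_value y (a :: w) = y a * word_value y w.
  by rewrite /word_value big_cons.
have := JD step JS; congr J.
rewrite mulrBr mulrDr -scalerAr /anticommutator.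
have -> : word_value y (a :: rem z w) = y a * word_value y (rem z w).
  by rewrite /word_value big_cons.
rewrite exprS mulN1r scaleNr mulrDl scalerDr !mulrA.
by rewrite -[_ + _ + S2]addrA addKr -!addrA !opprD -!addrA addKr.
Qed.

Definition tail_terms (z : T) (F : seq (K * seq T)) :=
  [seq (t.1 * move_sign z t.2, rem z t.2) | t <- F].

Definition contracted_terms (z i : T) (F : seq (K * seq T)) :=
  [seq (t.1 * swap_sign z i t.2, rem i (rem z t.2)) | t <- F].

(** The reduction step of the multilinear case: the letter z disappears from every
word, alone or together with one other letter. *)
Lemma value_move_letter z s F : uniq (z :: s) ->
  (forall t, t \in F -> perm_eq t.2 (z :: s)) ->
  J (value y F -
     (y z * value y (tail_terms z F) +
      \sum_(i <- s) anticommutator (y z) (y i) *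
                    value y (contracted_terms z i F))).
Proof.
move=> us permF; rewrite /value !big_map mulr_sumr.
under [X in _ - (_ + X)]eq_bigr => i _ do rewrite /value big_map mulr_sumr.
rewrite exchange_big -big_split -sumrB /=; apply: ideal_sum => t /permF permt.
have ut : uniq t.2 by rewrite (perm_uniq permt).
have zt : z \in t.2 by rewrite (perm_mem permt) mem_head.
have perm_rem : perm_eq (rem z t.2) s.
  by rewrite -(perm_cons z) -(permPl (perm_to_rem zt)).
have := idealZ t.1 (move_letter_front ut zt); congr J.
rewrite scalerBr scalerDr (perm_big _ perm_rem) /= scaler_sumr.
rewrite scalerA scalerAr; congr (_ - (_ + _)).
by apply: eq_bigr => i _; rewrite scalerA scalerAr.
Qed.

End Ideals.

(** * Vectors orthogonal to a given finite family *)

Section CliffordVectors.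

Variables (K : fieldType) (V : lmodType K) (form : {symmetric V}).
Hypothesis char_not2 : 2%:R != 0 :> K.

Lemma form_sym u v : form u v = form v u.
Proof. by rewrite [LHS]hermC expr0 mul1r. Qed.

Lemma form_polar u v : form (u + v) (u + v) = form u u + form v v + form u v *+ 2.
Proof.
by rewrite linearDl !linearDr /= (form_sym v u) mulr2n addrACA -!addrA
   [form v v + _]addrC !addrA.
Qed.

Lemma clifford_anticommutator (C : algType K) (iota : {linear V -> C}) :
  clifford_map form iota -> forall u v,
  anticommutator (iota u) (iota v) = (form u v *+ 2)%:A.
Proof.
move=> sqr u v; have := sqr (u + v); rewrite linearD form_polar.
rewrite expr2 mulrDl !mulrDr -!expr2 !sqr !scalerDl /anticommutator => E.
apply: (@addrI _ ((form u u)%:A + (form v v)%:A)); rewrite -{}E.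
by rewrite addrACA; congr (_ + _); rewrite addrC.
Qed.

(** Repetitions are allowed, since two letters of a word may receive the same
vector. *)
Definition orthogonal_system (l : seq V) :=
  {in l &, forall u v, u = v \/ form u v = 0} /\
  {in l, forall u, form u u != 0}.

Lemma orthogonal_system_sub (l l' : seq V) :
  {subset l' <= l} -> orthogonal_system l -> orthogonal_system l'.
Proof.
by move=> sub [orth aniso]; split=> [u v /sub ul /sub|u /sub]; auto.
Qed.

Lemma orthogonal_system_cons (l : seq V) e :
  orthogonal_system l -> form e e != 0 ->
  (forall u, u \in l -> form u e = 0) -> orthogonal_system (e :: l).
Proof.
move=> [orth aniso] ee le; split=> [u v|u].
  rewrite !in_cons => /orP[/eqP->|ul] /orP[/eqP->|vl].
  - by left.
  - by right; rewrite form_sym le.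
  - by right; apply: le.
  exact: orth.
by rewrite in_cons => /orP[/eqP->//|]; apply: aniso.
Qed.

Hypothesis V_infinite : ~ finite_dimensional V.
Hypothesis form_nondeg : nondegenerate_form form.

(** If no such e exists, the form is zero on all w - proj w, where proj is the
orthogonal projection onto the span of l; since w - proj w is also orthogonal to l,
it is in the radical. Hence w = proj w, and l spans V. *)
Lemma fresh_orthogonal_vector (l : seq V) : orthogonal_system l ->
  exists2 e, form e e != 0 & forall u, u \in l -> form u e = 0.
Proof.
move=> [orth aniso].
(* Repetitions are removed: each vector contributes once to the projection. *)
pose proj u := \sum_(x <- undup l) (form u x / form x x) *: x.
have proj_orth u x : x \in l -> form (u - proj u) x = 0.
  move=> xl; rewrite linearBl /= linear_sumlz /=.
  rewrite (bigD1_seq x) ?mem_undup ?undup_uniq //= big_seq_cond big1 => [|z].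
    by rewrite addr0 linearZl_LR /= divfK ?subrr ?aniso.
  rewrite mem_undup => /andP[zl /eqP zx]; rewrite linearZl_LR /=.
  by case: (orth z x zl xl) => [//|->]; rewrite mulr0.
apply: NNPP => no_fresh; apply: V_infinite; exists l => u.
have isotropic w : (forall x, x \in l -> form w x = 0) -> form w w = 0.
  move=> wl; apply/eqP; apply: contra_notT no_fresh => ww.
  by exists w => // x xl; rewrite form_sym wl.
have -> : u = proj u.
  apply/eqP; rewrite -subr_eq0; apply/eqP/form_nondeg => v.
  have -> : form (u - proj u) v = form (u - proj u) (v - proj v).
    rewrite [RHS]linearBr /= [X in _ = _ - X]linear_sumr /=.
    rewrite big_seq big1 ?subr0 // => x; rewrite mem_undup => xl.
    by rewrite linearZr_LR /= proj_orth ?mulr0.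
  have := isotropic ((u - proj u) + (v - proj v)).
  rewrite form_polar !isotropic; try by move=> x xl; apply: proj_orth.
  rewrite !add0r -mulr_natr => /(_ _)/eqP; rewrite mulf_eq0 (negPf char_not2) orbF.
  by move=> H; apply/eqP/H => x xl; rewrite linearDl /= !proj_orth ?addr0.
exists [seq (form u x / form x x, x) | x <- undup l]; last by rewrite big_map.
by move=> t /mapP[x]; rewrite mem_undup => ? ->.
Qed.

End CliffordVectors.

(** * Multilinear identities *)

Section MultilinearIdentities.

Variables (K : fieldType) (V : lmodType K) (form : {symmetric V}).
Hypothesis char_not2 : 2%:R != 0 :> K.
Hypothesis V_infinite : ~ finite_dimensional V.
Hypothesis form_nondeg : nondegenerate_form form.

Variables (C : algType K) (iota : {linear V -> C}).
Hypothesis iota_clifford : clifford_map form iota.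

Variable T : eqType.
Implicit Types (s : seq T) (F : seq (K * seq T)).

Definition vanishes_on_orthogonal s F := forall v : T -> V,
  orthogonal_system form [seq v i | i <- s] -> value (iota \o v) F = 0.

Lemma perm_tail_terms z s F : (forall t, t \in F -> perm_eq t.2 (z :: s)) ->
  forall t, t \in tail_terms z F -> perm_eq t.2 s.
Proof.
move=> permF _ /mapP[t /permF permt ->] /=.
have zt : z \in t.2 by rewrite (perm_mem permt) mem_head.
by rewrite -(perm_cons z) -(permPl (perm_to_rem zt)).
Qed.

Lemma perm_contracted_terms z i s F : i \in s ->
  (forall t, t \in F -> perm_eq t.2 (z :: s)) ->
  forall t, t \in contracted_terms z i F -> perm_eq t.2 (rem i s).
Proof.
move=> is_ permF _ /mapP[t tF ->] /=.
have permt := @perm_tail_terms z s F permF _ (map_f _ tF).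
have it : i \in rem z t.2 by rewrite (perm_mem permt).
by rewrite -(perm_cons i) -(permPl (perm_to_rem it)) -(permPr (perm_to_rem is_)).
Qed.

Lemma clifford_anticommutator_central u v w :
  commutator (anticommutator (iota u) (iota v)) (iota w) = 0.
Proof.
rewrite (clifford_anticommutator iota_clifford) /commutator.
by rewrite -scalerAl -scalerAr mul1r mulr1 subrr.
Qed.

Lemma clifford_value_move_letter z s F (v : T -> V) : uniq (z :: s) ->
  (forall t, t \in F -> perm_eq t.2 (z :: s)) ->
  value (iota \o v) F =
    iota (v z) * value (iota \o v) (tail_terms z F) +
    \sum_(i <- s) (form (v z) (v i) *+ 2) *:
                  value (iota \o v) (contracted_terms z i F).
Proof.
move=> us permF; have anti := clifford_anticommutator iota_clifford.
have central := clifford_anticommutator_central.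
have /subr0_eq-> := value_move_letter (y := iota \o v) (zero_ideal C)
  (fun i j k => central (v i) (v j) (v k)) us permF.
by congr (_ + _); apply: eq_bigr => i _; rewrite anti -scalerAl mul1r.
Qed.

(** Giving z a fresh vector e kills every {z, x_i}, and e is invertible because its
square is a nonzero scalar. *)
Lemma tail_terms_vanish z s F : uniq (z :: s) ->
  (forall t, t \in F -> perm_eq t.2 (z :: s)) ->
  vanishes_on_orthogonal (z :: s) F ->
  vanishes_on_orthogonal s (tail_terms z F).
Proof.
move=> us permF vanF v ov; have /andP[zNs _] := us.
have [e ee ve] := fresh_orthogonal_vector char_not2 V_infinite form_nondeg ov.
have ve' i : i \in s -> form (v i) e = 0 by move=> is_; apply/ve/map_f.
have [v' v'z v'E] : exists2 v' : T -> V, v' z = e & {in s, v' =1 v}.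
  exists (fun i => if i == z then e else v i); first by rewrite eqxx.
  by move=> i is_; case: eqP zNs is_ => // -> /negPf->.
have ov' : orthogonal_system form [seq v' i | i <- z :: s].
  apply: orthogonal_system_sub (orthogonal_system_cons ov ee ve) => u /mapP[i].
  rewrite in_cons => /orP[/eqP-> ->|is_ ->]; first by rewrite v'z mem_head.
  by rewrite v'E // in_cons map_f ?orbT.
have := vanF _ ov'.
rewrite (clifford_value_move_letter _ us permF) big_seq big1 => [|i is_].
  rewrite addr0 v'z => /(congr1 ( *%R (iota e))).
  rewrite mulr0 mulrA -expr2 iota_clifford -scalerAl mul1r => /eqP.
  rewrite scaler_eq0 (negPf ee) => /eqP <-.
  apply: (eq_value (perm_tail_terms permF)) => i is_.
  by rewrite /= v'E.
by rewrite v'z v'E // form_sym ve' // mul0rn scale0r.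
Qed.

(** Giving z and i the same fresh vector e kills every {z, x_k} with k != i; the
tail terms vanish by the preceding lemma, and 2<e, e> is invertible. *)
Lemma contracted_terms_vanish z i s F : uniq (z :: s) -> i \in s ->
  (forall t, t \in F -> perm_eq t.2 (z :: s)) ->
  vanishes_on_orthogonal (z :: s) F ->
  vanishes_on_orthogonal (rem i s) (contracted_terms z i F).
Proof.
move=> us is_ permF vanF v ov; have /andP[zNs us'] := us.
have [e ee ve] := fresh_orthogonal_vector char_not2 V_infinite form_nondeg ov.
have ve' k : k \in rem i s -> form (v k) e = 0 by move=> ks; apply/ve/map_f.
have [v' [v'z v'i v'E]] : exists v' : T -> V,
    [/\ v' z = e, v' i = e & {in rem i s, v' =1 v}].
  exists (fun k => if (k == z) || (k == i) then e else v k); split.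
  - by rewrite eqxx.
  - by rewrite eqxx orbT.
  move=> k; rewrite mem_rem_uniq // !inE => /andP[/negPf-> ks].
  by case: eqP zNs ks => // -> /negPf->.
have ov' : orthogonal_system form [seq v' k | k <- z :: s].
  apply: orthogonal_system_sub (orthogonal_system_cons ov ee ve) => u /mapP[k].
  rewrite in_cons => /orP[/eqP-> ->|ks ->]; first by rewrite v'z mem_head.
  have [->|ki] := eqVneq k i; first by rewrite v'i mem_head.
  have ks' : k \in rem i s by rewrite mem_rem_uniq // !inE ki.
  by rewrite v'E // in_cons map_f ?orbT.
have vanT := tail_terms_vanish us permF vanF.
have := vanF _ ov'.
rewrite (clifford_value_move_letter _ us permF) vanT; last first.
  by apply: orthogonal_system_sub ov' => x xs; rewrite in_cons xs orbT.
rewrite mulr0 add0r (bigD1_seq i) //= big_seq_cond big1 => [|k /andP[ks ki]].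
  rewrite addr0 v'z v'i -mulr_natr => /eqP.
  rewrite scaler_eq0 mulf_eq0 (negPf ee) (negPf char_not2) => /eqP <-.
  apply: (eq_value (perm_contracted_terms is_ permF)) => k ks.
  by rewrite /= v'E.
have ks' : k \in rem i s by rewrite mem_rem_uniq // !inE ki.
by rewrite v'z v'E // form_sym ve' // mul0rn scale0r.
Qed.

(** The degree drops by 1 in the tail terms and by 2 in the contracted ones. In
degree 0 the identity says that a scalar is 0 in C, hence in K. *)
Lemma multilinear_consequence (R : algType K) (J : R -> Prop) (y : T -> R) :
  two_sided_ideal J ->
  (forall i j k, J (commutator (anticommutator (y i) (y j)) (y k))) ->
  forall s F, uniq s -> (forall t, t \in F -> perm_eq t.2 s) ->
  vanishes_on_orthogonal s F -> J (value y F).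
Proof.
move=> idealJ central s; have [n] := ubnP (size s).
have [J0 JD JM] := idealJ.
elim: n s => [//|n IHn] [|z s] le_n F us permF vanF.
  have word1 (A : algType K) (g : T -> A) :
      value g F = (\sum_(t <- F) t.1) *: 1.
    rewrite scaler_suml; apply: eq_big_seq => t /permF/perm_nilP ->.
    by rewrite /word_value big_nil.
  have := vanF (fun=> 0) _; rewrite !word1 => /(_ _)/eqP.
  rewrite scaler_eq0 oner_eq0 orbF => /(_ _)/eqP->; first by rewrite scale0r.
  by split=> [x x'|x]; rewrite in_nil.
have := value_move_letter idealJ central us permF.
set X := (X in J (_ - X)) => JX; rewrite -[value y F](subrK X).
apply/(JD _ _ JX)/JD.
  have /andP[_ us'] := us.
  have := IHn s le_n _ us' (perm_tail_terms permF) (tail_terms_vanish us permF vanF).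
  by move=> /JM-/(_ (y z))[].
apply: ideal_sum idealJ _ _ _ _ => i is_.
have /andP[_ us'] := us.
have /IHn JC: (size (rem i s) < n)%N.
  by rewrite size_rem //; apply: leq_ltn_trans (leq_pred _) _.
have := JC _ (rem_uniq i us') (perm_contracted_terms is_ permF)
  (contracted_terms_vanish us is_ permF vanF).
by move=> /JM-/(_ (anticommutator (y z) (y i)))[].
Qed.

End MultilinearIdentities.

(** * Polarization and restitution of the top degree part *)

(** If x is outside A, the supersets of A with x and those without x are matched by
adding x, and their signs are opposite. *)
Lemma alternating_sum_supersets (K : pzRingType) (I : finType) (A : {set I}) :
  \sum_(U : {set I} | A \subset U) (-1) ^+ #|U| =
  if A == setT then (-1) ^+ #|I| else 0 :> K.
Proof.
have [->|] := eqVneq A setT.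
  by rewrite (big_pred1 setT) ?cardsT // => U; rewrite subTset.
rewrite -subTset => /subsetPn[x _ xNA]; rewrite (bigID (fun U : {set I} => x \in U)) /=.
rewrite (reindex_onto (fun U : {set I} => x |: U) (fun U => U :\ x)) /=; last first.
  by move=> U /andP[_ xU]; rewrite setD1K.
rewrite [X in X + _](_ : _ = - \sum_(U : {set I} | (A \subset U) && (x \notin U))
                                  (-1) ^+ #|U|) ?addNr //.
rewrite -sumrN; apply: eq_big => [U|U].
  rewrite setU11 andbT; have [xU|xNU] := boolP (x \in U).
    rewrite andbF; apply/negbTE; rewrite negb_and; apply/orP; right.
    by apply/eqP => /setP/(_ x); rewrite !inE eqxx xU.
  rewrite setU1K // eqxx !andbT; apply/subsetP/subsetP => AU a aA; last first.
    by rewrite in_setU1 AU ?orbT.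
  by have := AU a aA; rewrite in_setU1 => /orP[/eqP ax|//]; rewrite -ax aA in xNA.
case/andP => _ /eqP E; have xNU : x \notin U by rewrite -E !inE eqxx.
by rewrite cardsU1 xNU exprS mulN1r.
Qed.

Lemma injectiveb_imset (I : finType) (q : {ffun I -> I}) :
  injectiveb q = (q @: I == setT).
Proof.
rewrite eqEcard subsetT cardsT; apply/injectiveP/idP => [injq|le_q].
  by rewrite card_imset // leqnn.
have /imset_injP injq : #|q @: I| == #|I| by rewrite eqn_leq leq_imset_card.
by move=> a b; apply: injq.
Qed.

Section Polarization.

Variables (K : fieldType) (T : finType) (d : nat).
Implicit Types (F : seq (K * seq T)) (j : 'I_d -> T).

Local Notation inj_ffuns := [set q : {ffun 'I_d -> 'I_d} | injectiveb q].

(** The multilinear polynomial whose coefficient at the word q is the coefficient of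
the word j o q in F; its letters are the positions of j. *)
Definition polarized F j : seq (K * seq 'I_d) :=
  [seq (\sum_(t <- F | t.2 == [seq j p | p <- codom q]) t.1, codom q)
  | q : {ffun 'I_d -> 'I_d} <- enum inj_ffuns].

Lemma perm_polarized F j t : t \in polarized F j -> perm_eq t.2 (enum 'I_d).
Proof.
move=> /mapP[q]; rewrite mem_enum inE => injq -> /=.
apply: uniq_perm; [|exact: enum_uniq|].
  by rewrite map_inj_uniq ?enum_uniq //; apply/injectiveP.
by move=> x; rewrite mem_enum; apply: (injF_onto (injectiveP _ injq)).
Qed.

Variable R : algType K.

Lemma value_polarized F j (v : 'I_d -> R) : value v (polarized F j) =
  \sum_(t <- F) t.1 *: \sum_(q in inj_ffuns | t.2 == [seq j p | p <- codom q])
     word_value v (codom q).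
Proof.
rewrite /value big_map big_enum /=.
under eq_bigr => q _ do rewrite scaler_suml big_mkcond.
rewrite exchange_big; apply: eq_bigr => t _.
by rewrite scaler_sumr big_mkcondr.
Qed.

(* The product is noncommutative, so that the reordering lemma [big_enum] does not
apply: both sides must be seen to run over the same list. *)
Lemma word_value_codom m (v : 'I_d -> R) (q : {ffun 'I_m -> 'I_d}) :
  word_value v (codom q) = \prod_k v (q k).
Proof. by rewrite /word_value /codom /image_mem big_map enumT [index_enum _]unlock. Qed.

Lemma tuple_eq_map_codom m (j' : 'I_d -> T) (w : m.-tuple T)
    (q : {ffun 'I_m -> 'I_d}) :
  (w == [seq j' p | p <- codom q] :> seq T) = [forall k, j' (q k) == tnth w k].
Proof.
rewrite -map_comp -[X in X == _]map_tnth_enum; apply/eqP/forallP => [E k|E].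
  by apply/eqP; move/eq_in_map: E => /(_ k); rewrite mem_enum => ->.
by apply/eq_in_map => k _; rewrite /= (eqP (E k)).
Qed.

(** Expanding the product, a choice q of one position for each letter of w is counted
with the alternating sum over all U that contain the image of q. This is 0 unless q
is onto, which for w of length at most d forces length d and q bijective. *)
Lemma polarize_word j (v : 'I_d -> R) (w : seq T) : (size w <= d)%N ->
  \sum_(U : {set 'I_d})
    (-1) ^+ #|U| *: word_value (fun a => \sum_(p in U | j p == a) v p) w =
  (-1) ^+ d *: \sum_(q in inj_ffuns | w == [seq j p | p <- codom q])
     word_value v (codom q).
Proof.
move: (in_tuple w); rewrite -[w]/(tval (in_tuple w)).
move: (size w) (in_tuple w) => m {}w _; rewrite size_tuple => le_md.
pose fits (q : {ffun 'I_m -> 'I_d}) := [forall k, j (q k) == tnth w k].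
transitivity (\sum_(q | fits q) (if q @: 'I_m == setT then (-1) ^+ d else 0) *:
    \prod_k v (q k)).
  under eq_bigr => U _.
    rewrite /word_value big_tuple bigA_distr_big_dep scaler_sumr; over.
  rewrite (exchange_big_dep fits) /= => [|U q _ /familyP qU]; last first.
    by apply/forallP => k; have /andP[] := qU k.
  apply: eq_bigr => q fq; rewrite -scaler_suml.
  have := alternating_sum_supersets K (q @: 'I_m); rewrite card_ord => <-.
  congr (_ *: _); apply: eq_bigl => U.
  apply/familyP/subsetP => [qU _ /imsetP[k _ ->]|qU k].
    by have /andP[] := qU k.
  by apply/andP; split; [apply/qU/imset_f | apply: (forallP fq k)].
have [lt_md|ge_md] := ltnP m d.
  rewrite big1 => [|q _]; last first.
    case: eqP => [E|_]; last by rewrite scale0r.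
    have := leq_imset_card q 'I_m; rewrite E cardsT !card_ord.
    by rewrite leqNgt lt_md.
  rewrite big_pred0 ?scaler0 // => q; apply/negbTE/nandP; right.
  apply: contraTneq lt_md => /(congr1 size).
  by rewrite size_tuple size_map size_codom card_ord => ->; rewrite ltnn.
have E : m = d by apply/eqP; rewrite eqn_leq le_md ge_md.
move: w @fits; move/esym: E => E; case: m / E {le_md ge_md} => w fits.
rewrite scaler_sumr big_mkcond [RHS]big_mkcond; apply: eq_bigr => q _ /=.
rewrite tuple_eq_map_codom -/(fits q) inE injectiveb_imset word_value_codom.
by case: (fits q); case: eqP; rewrite ?scale0r.
Qed.

Lemma polarization F j (v : 'I_d -> R) :
  (forall t, t \in F -> size t.2 <= d)%N ->
  \sum_(U : {set 'I_d})
    (-1) ^+ #|U| *: value (fun a => \sum_(p in U | j p == a) v p) F =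
  (-1) ^+ d *: value v (polarized F j).
Proof.
move=> le_d; rewrite value_polarized /value.
under eq_bigr => U _ do rewrite scaler_sumr.
rewrite exchange_big scaler_sumr /=; apply: eq_big_seq => t /le_d le_t.
rewrite [RHS]scalerA mulrC -scalerA -polarize_word // scaler_sumr.
by apply: eq_bigr => U _; rewrite !scalerA mulrC.
Qed.

(** For a bijection q and a word w of length d there is exactly one j with
w = j o q, so each term of degree d is counted once for each q. *)
Lemma restitution F (y : T -> R) :
  \sum_(j : {ffun 'I_d -> T}) value (y \o j) (polarized F j) =
  #|inj_ffuns|%:R *: value y [seq t <- F | size t.2 == d].
Proof.
under eq_bigr => j _ do rewrite value_polarized.
rewrite exchange_big /= {1}/value big_filter [in RHS]big_mkcond /= scaler_sumr.
apply: eq_bigr => -[c w] _ /=; rewrite -scaler_sumr.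
under eq_bigr => j _.
  rewrite (eq_bigr (fun=> word_value y w)) => [|q /andP[_ /eqP->]]; last first.
    by rewrite /word_value big_map.
  rewrite big_mkcondr /=; over.
rewrite exchange_big /= (eq_bigr (fun=> if size w == d then word_value y w else 0)).
  by rewrite sumr_const -scaler_nat; case: ifP => _;
     rewrite ?scaler0 // !scalerA mulrC.
move=> q; rewrite inE => /injectiveP injq; rewrite -big_mkcond /=.
have [sw|sw] := eqVneq (size w) d; last first.
  rewrite big_pred0 // => j; apply: contra_neqF sw => /eqP->.
  by rewrite size_map size_codom card_ord.
have /eqP sw' := sw; pose tw := Tuple sw'; rewrite -[w]/(tval tw).
rewrite (big_pred1 [ffun p => tnth tw (invF injq p)]) // => j.
rewrite tuple_eq_map_codom; apply/forallP/eqP => [jq|-> k].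
  by apply/ffunP => p; rewrite ffunE -(eqP (jq _)) f_invF.
by rewrite ffunE invF_f.
Qed.

End Polarization.

(** * Identities of arbitrary degree *)

Section CliffordIdentities.

Variables (K : fieldType) (V : lmodType K) (form : {symmetric V}).
Hypothesis natK_eq0 : forall n, (n%:R == 0 :> K) = (n == 0)%N.
Hypothesis V_infinite : ~ finite_dimensional V.
Hypothesis form_nondeg : nondegenerate_form form.

Variables (C : algType K) (iota : {linear V -> C}).
Hypothesis iota_clifford : clifford_map form iota.

Variable T : finType.

Definition identity_on_vectors (F : seq (K * seq T)) :=
  forall v : T -> V, value (iota \o v) F = 0.

(** Each polarization of F is a multilinear identity, hence holds modulo J; their
sum at y is d! times the top degree part, and d! is invertible. *)
Lemma top_degree_consequence d (F : seq (K * seq T)) :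
  (forall t, t \in F -> size t.2 <= d)%N -> identity_on_vectors F ->
  forall (R : algType K) (J : R -> Prop) (y : T -> R), two_sided_ideal J ->
  (forall a b c, J (commutator (anticommutator (y a) (y b)) (y c))) ->
  J (value y [seq t <- F | size t.2 == d]).
Proof.
move=> le_d idF R J y idealJ central.
set N := #|[set q : {ffun 'I_d -> 'I_d} | injectiveb q]|.
have N_neq0 : N%:R != 0 :> K.
  by rewrite natK_eq0 -lt0n /N card_inj_ffuns !card_ord ffactnn fact_gt0.
have := restitution d F y; rewrite -/N => /(congr1 ( *:%R N%:R^-1)).
rewrite scalerA mulVf // scale1r => <-.
apply: idealZ => //; apply: ideal_sum => // j _.
apply: (multilinear_consequence _ V_infinite form_nondeg iota_clifford idealJ
  _ (enum_uniq _) (@perm_polarized _ _ _ F j)) => [|a b c|v _].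
- by rewrite natK_eq0.
- exact: central.
have : (-1) ^+ d *: value (iota \o v) (polarized F j) = 0.
  rewrite -polarization // big1 // => U _.
  have := idF (fun a => \sum_(p in U | j p == a) v p).
  rewrite (_ : value _ F = value (fun a => \sum_(p in U | j p == a) iota (v p)) F).
    by move->; rewrite scaler0.
  apply: eq_bigr => t _; congr (_ *: _); apply: eq_bigr => a _.
  by rewrite /= linear_sum.
by move=> /eqP; rewrite scaler_eq0 signr_eq0 => /eqP.
Qed.

(** The top degree part is itself an identity, by [top_degree_consequence] for C and
its zero ideal, so subtracting it lowers the degree. *)
Lemma identity_consequence (F : seq (K * seq T)) : identity_on_vectors F ->
  forall (R : algType K) (J : R -> Prop) (y : T -> R), two_sided_ideal J ->
  (forall a b c, J (commutator (anticommutator (y a) (y b)) (y c))) ->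
  J (value y F).
Proof.
have [d] : exists d, forall t, t \in F -> (size t.2 < d)%N.
  exists (\max_(t <- F) size t.2).+1 => t tF.
  by rewrite ltnS (big_rem t tF) leq_maxl.
elim: d F => [|d IHd] F lt_d idF R J y idealJ central.
  have [J0 _ _] := idealJ; suff -> : F = [::] by rewrite /value big_nil.
  by case: F lt_d {idF} => // t F /(_ t (mem_head _ _)).
have split_top (A : algType K) (g : T -> A) : value g F =
    value g [seq t <- F | size t.2 == d] + value g [seq t <- F | size t.2 != d].
  by rewrite /value (bigID (fun t => size t.2 == d)) !big_filter.
have [_ JD _] := idealJ; rewrite split_top; apply: JD.
  exact: top_degree_consequence.
apply: IHd => // [t|v].
  by rewrite mem_filter ltn_neqAle => /andP[-> /lt_d].
rewrite -(idF v) split_top.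
suff -> : value (iota \o v) [seq t <- F | size t.2 == d] = 0 by rewrite add0r.
apply: (@top_degree_consequence _ _ lt_d idF _ (fun x : C => x = 0)) => [|a b c].
  exact: zero_ideal.
exact: (clifford_anticommutator_central iota_clifford).
Qed.

End CliffordIdentities.

(** * Polynomials of the free algebra as lists of weighted words *)

Definition terms (K : fieldType) (f : free_alg K) : seq (K * seq nat) :=
  [seq (f@_k, k : seq nat) | k : {fmonom nat} <- finmap.enum_fset (msupp f)].

Lemma eval_terms (K : fieldType) (R : lalgType K) (g : nat -> R) f :
  eval g f = value g (terms f).
Proof.
rewrite /eval /mmap /value big_map; apply: eq_bigr => k _.
by rewrite /= -scalerAl mul1r.
Qed.

Lemma monomial_word (K : fieldType) (m : {fmonom nat}) :
  << m >> = word_value x_ m :> free_alg K.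
Proof.
case: m => w; rewrite /word_value /=; elim: w => [|i w IHw].
  by rewrite big_nil; congr (<< _ >>); apply/eqP; rewrite fmP fm1.
rewrite big_cons -IHw /x_ malgM_def fgmulUU mulr1.
by congr (<< _ >>); apply/eqP; rewrite fmP fmM fmU.
Qed.

Lemma free_alg_terms (K : fieldType) (f : free_alg K) : f = value x_ (terms f).
Proof.
rewrite {1}[f]monalgE /value big_map; apply: eq_bigr => k _ /=.
apply/malgP => k'; rewrite -monomial_word mcoeffZ !mcoeffU mulr_natr.
by case: eqP.
Qed.

Lemma free_alg_scalerAr (K : fieldType) (c : K) (f g : free_alg K) :
  c *: (f * g) = f * (c *: g).
Proof.
apply/malgP => k; rewrite mcoeffZ mcoeffMl.
rewrite (mcoeffMlw _ (finmap.fsubset_refl _) (msuppZ_le c g)).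
rewrite mulr_sumr; apply: eq_bigr => k1 _; rewrite mulr_sumr.
by apply: eq_bigr => k2 _; rewrite mcoeffZ mulrnAr mulrCA.
Qed.

(** The carrier is unchanged; the structure adds that scalars are central, so that
the free algebra is an instance of the preceding sections. *)
Definition free_algType (K : fieldType) : algType K :=
  HB.pack_for (algType K) (free_alg K)
    (GRing.Lalgebra_isAlgebra.Build K (free_alg K) (@free_alg_scalerAr K)).

Lemma eval_var (K : fieldType) (R : lalgType K) (g : nat -> R) i :
  eval g (x_ i) = g i.
Proof. by rewrite /eval mmapU fmU big_seq1 /= scale1r mul1r. Qed.

Lemma eval_is_multiplicative (K : fieldType) (R : algType K) (g : nat -> R) :
  multiplicative (eval g).
Proof.
have word_morph : mmorphism (fun m : {fmonom nat} => \prod_(i <- m) g i).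
  by split=> [m1 m2|]; rewrite ?fmM ?big_cat // fm1 big_nil.
pose h := MMorphism.Pack (MMorphism.Class (isMultiplicative.Build _ _ _ word_morph)).
apply: (commr_mmap_is_multiplicative (h := h)) => f m m'.
by rewrite /GRing.comm /= -scalerAl -scalerAr mul1r mulr1.
Qed.

Lemma evalZ (K : fieldType) (R : algType K) (g : nat -> R) c p :
  eval g (c *: p) = c *: eval g p.
Proof.
have [evalM _] := eval_is_multiplicative g.
by rewrite -mul_malgC evalM /eval mmapU fm1 big_nil mulr1 -scalerAl mul1r.
Qed.

Lemma eval_generator (K : fieldType) (R : algType K) (g : nat -> R) :
  eval g (commutator (x_ 0 ^+ 2) (x_ 1)) = commutator (g 0%N ^+ 2) (g 1%N).
Proof.
have [evalM _] := eval_is_multiplicative g.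
by rewrite /commutator {1}/eval raddfB /= -!/(eval g _) !expr2 !evalM !eval_var.
Qed.

Lemma eval_spX (K : fieldType) (V : lmodType K) (R : algType K)
    (phi : {linear V -> R}) (g : nat -> R) (p : free_alg K) :
  (forall i, exists v, g i = phi v) -> spX p -> exists v, eval g p = phi v.
Proof.
move=> gV [s sX ->]; rewrite /eval raddf_sum /= big_seq.
elim/big_ind: _ => [|_ _ [u ->] [v ->]|t /sX[i ->]].
- by exists 0; rewrite raddf0.
- by exists (u + v); rewrite raddfD.
have [v gv] := gV i; exists (t.1 *: v).
by rewrite -/(eval g _) evalZ eval_var gv linearZ.
Qed.

(** Polarization of the square: it makes {a, b} central as soon as all squares of
linear forms are. *)
Lemma commutator_anticommutator (R : nzRingType) (a b c : R) :
  commutator (anticommutator a b) c =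
  commutator ((a + b) ^+ 2) c - commutator (a ^+ 2) c - commutator (b ^+ 2) c.
Proof.
have -> : (a + b) ^+ 2 = a ^+ 2 + b ^+ 2 + anticommutator a b.
  rewrite !expr2 mulrDl !mulrDr /anticommutator [RHS]addrACA.
  by congr (_ + _); rewrite addrC.
have commD x y : commutator (x + y) c = commutator x c + commutator y c.
  by rewrite /commutator mulrDl mulrDr opprD addrACA.
move: (anticommutator a b) => z; rewrite !commD.
by rewrite -[RHS]addrA -opprD [X in _ = X - _]addrC addrK.
Qed.

Theorem theorem1 (K : fieldType) (charK0 : [pchar K] =i pred0)
    (V : lmodType K) (V_infinite : ~ finite_dimensional V)
    (form : {symmetric V}) (form_nondeg : nondegenerate_form form)
    (C : algType K) (iota : {linear V -> C})
    (C_clifford : is_clifford_algebra form iota) :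
  forall f : free_alg K,
    weak_identity (fun c : C => exists v, c = iota v) f <->
    GL_ideal_generated
      (fun h : free_alg K => h = commutator (x_ 0 ^+ 2) (x_ 1)) f.
Proof.
have [iota_clifford _] := C_clifford.
move=> f; split=> [idf J idealJ genJ|]; last first.
  apply; last first.
    move=> _ [_ [-> [omega [omegaX ->]]]] g gV.
    have evalM := eval_is_multiplicative g.
    rewrite (@eval_generator K (free_algType K)).
    have [u omega_u] := eval_spX gV (omegaX 0).
    rewrite /commutator /eval raddfB /= -!/(eval g _) !expr2 !evalM omega_u.
    by rewrite -expr2 iota_clifford -scalerAl -scalerAr mul1r mulr1 subrr.
  split=> [g _|a b ida idb g gV|r a ida].
  - by rewrite /eval raddf0.
  - by rewrite /eval raddfD /= -!/(eval g _) ida ?idb ?addr0.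
  have evalM g := (eval_is_multiplicative (g : nat -> C)).1.
  by split=> g gV; rewrite evalM ida // ?mulr0 ?mul0r.
have genJ' (p q : free_alg K) : spX p -> spX q -> J (commutator (p ^+ 2) q).
  move=> pX qX; apply: genJ; exists (commutator (x_ 0 ^+ 2) (x_ 1)); split=> //.
  exists (fun i => if i == 0 then p else q); split; first by case.
  by rewrite (@eval_generator K (free_algType K)).
have idealJA : @two_sided_ideal (free_algType K) J by exact: idealJ.
have spX_var i : spX (x_ i : free_alg K).
  exists [:: (1, x_ i)]; last by rewrite big_seq1 scale1r.
  by move=> t; rewrite inE => /eqP->; exists i.
have spX_add i j : spX (x_ i + x_ j : free_alg K).
  exists [:: (1, x_ i); (1, x_ j)]; last by rewrite big_cons big_seq1 !scale1r.
  by move=> t; rewrite !inE => /orP[] /eqP->; [exists i | exists j].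
(* [identity_consequence] is about a finite type of letters, and only finitely
   many variables occur in f: all are at most n, hence fixed by inord. *)
pose n := \max_(t <- terms f) \max_(i <- t.2) i.
have letters_le t : t \in terms f -> {in t.2, forall i, i <= n}%N.
  move=> tf i it; rewrite /n (big_rem t tf) (big_rem i it) /=.
  by rewrite !leq_max leqnn.
pose F := [seq (t.1, [seq inord i : 'I_n.+1 | i <- t.2]) | t <- terms f].
have value_F (R : lalgType K) (g : nat -> R) :
    value g (terms f) = value (g \o val) F.
  rewrite [RHS]/value big_map; apply: eq_big_seq => t /letters_le le_t.
  congr (_ *: _); rewrite [RHS]/word_value big_map; apply: eq_big_seq => i it.
  by rewrite /= inordK // ltnS le_t.
rewrite (free_alg_terms f) value_F.
apply: (identity_consequence _ V_infinite form_nondeg iota_clifford _ idealJA).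
- exact/pcharf0P.
- move=> v; rewrite /value big_map.
  have /= := idf (fun i => iota (v (inord i))) (fun i => ex_intro _ _ erefl).
  rewrite eval_terms => idf_v; rewrite -[RHS]idf_v.
  apply: eq_bigr => t _; congr (_ *: _).
  by rewrite /word_value big_map.
move=> a b c; rewrite commutator_anticommutator.
by apply: (idealB idealJA); first apply: (idealB idealJA);
   apply: genJ' (spX_var _); [apply: spX_add | apply: spX_var | apply: spX_var].
Qed.
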